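(* Let $(\mathbb N,E)$ be a self-similar graph satisfying the assumption that for every $e\in E^1$ there is $m\in\mathbb N$ with $m|_e\neq0$, and let $(\mathcal V,\mathcal S)$ be a unitary + CK type representation of $(\mathbb N,E)$. Then $(\mathcal V,\mathcal S)$ is a maximal representation.
   Context: Graphs. $E=(E^0,E^1,r,s)$ is a finite directed graph (vertices $E^0$, edges $E^1$, range and source maps $r,s$), source-free: $vE^1:=\{e\in E^1: r(e)=v\}\neq\emptyset$ for every $v\in E^0$. $E^*$ is the set of finite paths (vertices are paths of length $0$; $\mu\nu$ is a path when $s(\mu)=r(\nu)$). $\mathbb N=\{0,1,2,\dots\}$. $\operatorname{Aut}(E)$ is the group of bijections of $E^0\cup E^1$ preserving $E^0$ and $E^1$ and commuting with $r$ and $s$. Self-similar graph $(\mathbb N,E)$: a semigroup homomorphism $\mathbb N\to\operatorname{Aut}(E)$, written $p\cdot\mu$, together with a restriction map $\mathbb N\times(E^0\cup E^1)\to\mathbb N$, $(p,\mu)\mapsto p|_\mu$, such that $(p+q)|_\mu=p|_{q\cdot\mu}+q|_\mu$; $p|_v=p$ for $v\in E^0$; $0|_e=0$ for $e\in E^1$; and $p|_e\cdot v=p\cdot v$ whenever $s(e)=v$. TCK families. A Toeplitz-Cuntz-Krieger (TCK) $E$-family $\mathcal S=\{S_\mu:\mu\in E^0\cup E^1\}$ consists of pairwise orthogonal projections $S_v$ ($v\in E^0$) and operators $S_e$ ($e\in E^1$) with $S_e^*S_e=S_{s(e)}$ and $\sum_{e\in vE^1}S_eS_e^*\le S_v$ for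 all $v$. It is Cuntz-Krieger (CK) if equality holds for all $v$. For $\mu=e_1\cdots e_k$, $S_\mu=S_{e_1}\cdots S_{e_k}$. Families are taken nondegenerate: $\sum_{v\in E^0}S_v=I$. (Toeplitz) representation of $(\mathbb N,E)$ on a Hilbert space: a pair $(\mathcal V,\mathcal S)$ with $\mathcal V=\{V_p\}_{p\in\mathbb N}$ isometries, $V_pV_q=V_{p+q}$, $V_0=I$, and $\mathcal S$ a TCK $E$-family, such that $V_pS_\mu=S_{p\cdot\mu}V_{p|_\mu}$ and $V_p^*S_{p\cdot\mu}=S_\mu V_{p|_\mu}^*$ for all $p\in\mathbb N$, $\mu\in E^0\cup E^1$. It is of unitary + CK type if $V_1$ is unitary and $\mathcal S$ is CK. $\mathcal A_{\mathbb N,E}$ is the norm-closed operator algebra generated by the operators $S_\mu V_p$ ($\mu\in E^*$, $p\in\mathbb N$) in the direct sum of all Toeplitz representations of $(\mathbb N,E)$; a Toeplitz representation is regarded as a completely contractive representation of $\mathcal A_{\mathbb N,E}$. A dilation of a completely contractive representation $\rho:\mathcal A\to\mathcal B(\mathcal H)$ is a completely contractive representation $\pi:\mathcal A\to\mathcal B(\mathcal K)$ with $\mathcal H\subseteq\mathcal K$ and $\rho(a)=P_{\mathcal H}\pi(a)|_{\mathcal H}$ for all $a\in\mathcal A$. $\rho$ is maximal if every dilation $\pi$ of $\rho$ has the form $\pi=\rho\oplus\sigma$. *)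

(* Defs.v *)
From HB Require Import structures.
From mathcomp Require Import all_boot all_order all_algebra all_fingroup.
From mathcomp Require Import all_classical all_reals all_analysis.
From mathcomp Require Import sesquilinear complex ring.

Set Implicit Arguments.
Unset Strict Implicit.
Unset Printing Implicit Defensive.

Import Order.TTheory GRing.Theory Num.Theory.
Import numFieldNormedType.Exports.

Local Open Scope classical_set_scope.
Local Open Scope ring_scope.

(* The inner product is linear in its first argument. *)
Record hilbert (R : realType) := Hilbert {
  hspace :> completeNormedModType R[i];
  hdot : {dot hspace for Num.conj};
  hnormE : forall x : hspace, `|x| ^+ 2 = hdot x x }.

Notation "''<' x , y '>'" := (hdot _ x y)
  (at level 8, x at level 69, y at level 69, format "''<' x ,  y '>'").

Record bop (R : realType) (H K : hilbert R) := Bop {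
  bop_lin :> {linear H -> K};
  bop_cont : continuous bop_lin }.

Section Operators.
Variable R : realType.
Implicit Types H K L : hilbert R.

Lemma bop_bounded H K (f : bop H K) :
  exists2 M : R[i], 0 < M & forall x, `|f x| <= M * `|x|.
Proof.
have /linear_bounded_continuous/linear_boundedP := @bop_cont _ _ _ f.
by move/pinfty_ex_gt0.
Qed.

Lemma bounded_bop H K (f : {linear H -> K}) (M : R[i]) :
  (forall x, `|f x| <= M * `|x|) -> continuous f.
Proof.
move=> fM; apply: bounded_linear_continuous; apply/bounded_funP => r.
exists (`|M| * `|r|) => x xr; apply: le_trans (fM x) _.
have M0 : M * `|x| \is Num.real by rewrite ger0_real// (le_trans _ (fM x)).
rewrite (le_trans (real_ler_norm M0))// normrM normr_id ler_wpM2l//.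
have r0 : 0 <= r by rewrite (le_trans _ xr).
by rewrite (ger0_norm r0).
Qed.

Definition bop0 H K : bop H K := @Bop R H K (\0%R) (@cst_continuous _ _ 0).

Lemma bop_add_cont H K (f g : bop H K) : continuous (f \+ g).
Proof. by move=> x; apply: cvgD; exact: bop_cont. Qed.

Definition bop_add H K (f g : bop H K) : bop H K :=
  @Bop R H K (f \+ g) (@bop_add_cont H K f g).

Lemma bop_scale_cont H K (c : R[i]) (f : bop H K) : continuous (c \*: f).
Proof. by move=> x; apply: cvgZr; exact: bop_cont. Qed.

Definition bop_scale H K (c : R[i]) (f : bop H K) : bop H K :=
  @Bop R H K (c \*: f) (@bop_scale_cont H K c f).

Lemma bop_comp_cont H K L (f : bop K L) (g : bop H K) : continuous (f \o g).
Proof. by move=> x; apply: continuous_comp; exact: bop_cont. Qed.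

Definition bop_comp H K L (f : bop K L) (g : bop H K) : bop H L :=
  @Bop R H L (f \o g) (@bop_comp_cont H K L f g).

Local Notation cRe := (@complex.Re _).

Lemma hdotC H (x y : H) : hdot H x y = (hdot H y x)^*.
Proof. by have := hermC (hdot H) x y; rewrite expr0 mul1r. Qed.

Lemma hdotDl H (x y z : H) : hdot H (x + y) z = hdot H x z + hdot H y z.
Proof. exact: linearDl. Qed.

Lemma hdotZl H (a : R[i]) (x z : H) : hdot H (a *: x) z = a * hdot H x z.
Proof. exact: linearZl_LR. Qed.

Lemma hdotDr H (x y z : H) : hdot H x (y + z) = hdot H x y + hdot H x z.
Proof. by rewrite hdotC hdotDl rmorphD /= -!hdotC. Qed.

Lemma hdotZr H (a : R[i]) (x z : H) : hdot H x (a *: z) = a^* * hdot H x z.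
Proof. by rewrite hdotC hdotZl rmorphM /= -hdotC. Qed.

Lemma hnormDE H (x y : H) :
  `|x + y| ^+ 2 = `|x| ^+ 2 + `|y| ^+ 2 + 2 * 'Re (hdot H x y).
Proof.
rewrite !hnormE hdotDl !hdotDr (hdotC y x) -!hnormE.
rewrite (_ : 2 * 'Re _ = hdot H x y + (hdot H x y)^*); first by ring.
by rewrite ReE mulrC divfK.
Qed.

Lemma parallelogram H (x y : H) :
  `|x + y| ^+ 2 + `|x - y| ^+ 2 = 2 * (`|x| ^+ 2 + `|y| ^+ 2).
Proof.
rewrite !hnormDE normrN -scaleN1r hdotZr rmorphN rmorph1 mulN1r raddfN /=.
by ring.
Qed.

Section Riesz.
Variables (H : hilbert R) (f : {linear H -> R[i]^o}) (M : R[i]).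
Hypotheses (M0 : 0 < M) (fM : forall x, `|f x| <= M * `|x|).

Let phi (x : H) : R[i] := `|x| ^+ 2 - 2 * 'Re (f x).

Let phi_real x : phi x \is Num.real.
Proof. by rewrite rpredB// ?rpredX ?normr_real// rpredM// ?Creal_Re// realn. Qed.

Let phi_lb x : - M ^+ 2 <= phi x.
Proof.
rewrite -subr_ge0 opprK.
apply: le_trans (_ : 0 <= `|(`|x| - M)| ^+ 2) _; first exact: exprn_ge0.
rewrite real_normK ?rpredB ?normr_real ?gtr0_real// sqrrB lerD2r /phi lerD2l lerN2.
rewrite -[leRHS]mulr_natl ler_wpM2l// (le_trans (leif_Re_Creal (f x)))//.
by rewrite mulrC fM.
Qed.

Let phi_mid x y : phi x + phi y = 2 * phi (2^-1 *: (x + y)) + 2^-1 * `|x - y| ^+ 2.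
Proof.
have fE : f (2^-1 *: (x + y)) = 2^-1 * (f x + f y) by rewrite linearZ linearD.
rewrite /phi fE normrZ normfV normr_nat exprMn.
rewrite ReMl ?rpredV ?realn// raddfD/=.
have := parallelogram x y.
move: (`|x + y| ^+ 2) (`|x - y| ^+ 2) (`|x| ^+ 2) (`|y| ^+ 2) => a b c d abcd.
have -> : b = 2 * (c + d) - a by rewrite -abcd addrAC subrr add0r.
by field.
Qed.

Let E := [set cRe (phi x) | x in [set: H]].
Let m := inf E.

Let hasE : has_inf E.
Proof.
split; first by exists (cRe (phi 0)), 0.
exists (cRe (- M ^+ 2)) => _ [x _ <-].
by have := phi_lb x; rewrite lecE => /andP[].
Qed.

Let m_le x : (m%:C)%C <= phi x.
Proof.
rewrite -(RRe_real (phi_real x)) lecR ge_inf//; first by case: hasE.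
by exists x.
Qed.

Let m_appr n : exists x, phi x < (m%:C)%C + n.+1%:R^-1.
Proof.
have n0 : 0 < n.+1%:R^-1 :> R by rewrite invr_gt0.
have [_ [x _ <-] mx] := inf_adherent n0 hasE.
exists x; rewrite -(RRe_real (phi_real x)).
suff -> : n.+1%:R^-1 = ((n.+1%:R^-1)%:C)%C :> R[i] by rewrite -rmorphD ltcR.
by rewrite fmorphV rmorph_nat.
Qed.

Let u n := projT1 (cid (m_appr n)).
Let uE n : phi (u n) < (m%:C)%C + n.+1%:R^-1.
Proof. by rewrite /u; case: cid. Qed.

Let u_dist n k : `|u n - u k| ^+ 2 <= 2 * (n.+1%:R^-1 + k.+1%:R^-1).
Proof.
have := phi_mid (u n) (u k).
have := m_le (2^-1 *: (u n + u k)).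
have := ltW (uE n); have := ltW (uE k).
move: (phi (u k)) (phi (u n)) (phi (2^-1 *: _)) (m%:C)%C (`|_| ^+ 2) => a b c d e ad bd dc abce.
have -> : e = 2 * (b + a - 2 * c) by rewrite abce; field.
rewrite ler_wpM2l// lerBlDr.
apply: le_trans (lerD bd ad) _.
by rewrite addrACA addrC lerD2l (_ : d + d = 2 * d) ?ler_wpM2l//; ring.
Qed.

Let inv_small (e : R[i]) : 0 < e -> \forall n \near \oo, n.+1%:R^-1 < e.
Proof.
move=> e0; have er := RRe_real (gtr0_real e0).
have e0' : 0 < cRe e by rewrite -ltcR er.
have := near_infty_natSinv_lt (PosNum e0'); apply: filterS => n /=.
by rewrite -ltcR er fmorphV rmorph_nat.
Qed.

Let u_cvg : cvg (u @ \oo).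
Proof.
apply/cauchy_cvgP/cauchy_ballP => e e0; near_simpl.
have e2 : 0 < e ^+ 2 / 4 by rewrite divr_gt0 ?exprn_gt0.
have h := inv_small e2.
exists ([set n | n.+1%:R^-1 < e ^+ 2 / 4 :> R[i]], [set n | n.+1%:R^-1 < e ^+ 2 / 4 :> R[i]]) => //=.
move=> [n k] [/= hn hk]; rewrite -ball_normE /=.
rewrite -(@ltr_pXn2r _ 2) ?nnegrE// ?(ltW e0)//.
apply: le_lt_trans (u_dist _ _) _.
have -> : e ^+ 2 = 2 * (e ^+ 2 / 4 + e ^+ 2 / 4) by field.
by rewrite ltr_pM2l// ltrD.
Qed.

Let x0 := lim (u @ \oo).

Let phi_cvg : (phi (u n) : R[i]^o) @[n --> \oo] --> (phi x0 : R[i]^o).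
Proof.
have nc : (`|u n| : R[i]^o) @[n --> \oo] --> (`|x0| : R[i]^o).
  by apply: cvg_norm; exact: u_cvg.
apply: (@cvgB _ R[i]^o).
  exact: (cvgM nc nc).
apply: (@cvgM _ _ _ _ (cst (2 : R[i]^o))); first exact: cvg_cst.
apply/cvgrPdist_lt => e e0.
have fc : f (u n) @[n --> \oo] --> f x0.
  apply: continuous_cvg; last exact: u_cvg.
  apply: bounded_linear_continuous; apply/bounded_funP => r.
  exists (M * r) => x xr; apply: le_trans (fM x) _.
  by rewrite ler_wpM2l// ltW.
have /cvgrPdist_lt/(_ e e0) := fc; apply: filterS => n; apply: le_lt_trans.
by rewrite -raddfB/= (leif_normC_Re_Creal _).
Qed.

Let phi_x0 x : phi x0 <= phi x.
Proof.
apply: le_trans (m_le x); rewrite real_leNgt ?phi_real//; last first.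
  by apply/complex_realP; exists m.
apply/negP => mx; set e := (phi x0 - (m%:C)%C) / 2.
have e0 : 0 < e by rewrite divr_gt0// subr_gt0.
have /cvgrPdist_lt/(_ e e0) h := phi_cvg.
have [n [/= h1 h2]] := filter_ex (filterI (inv_small e0) h).
have h3 : phi x0 - phi (u n) < e.
  by apply: le_lt_trans h2; apply: real_ler_norm; rewrite rpredB.
have : phi x0 < e + ((m%:C)%C + e).
  rewrite -(subrK (phi (u n)) (phi x0)) ltrD// (lt_trans (uE n))//.
  by rewrite ltrD2l.
rewrite (_ : e + _ = phi x0) ?ltxx//.
by rewrite /e; field.
Qed.

Let re0 z : 'Re (hdot H z x0 - f z) = 0.
Proof.
set c := 'Re _; have cR : c \is Num.real by exact: Creal_Re.
pose d := `|z| ^+ 2 + 1.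
have d0 : 0 < d by rewrite ltr_wpDl// exprn_ge0.
pose t := - c / d; have tR : t \is Num.real.
  by rewrite rpredM ?rpredN// rpredV gtr0_real.
have := phi_x0 (t *: z + x0).
rewrite /phi hnormDE hdotZl ReMl//.
have -> : f (t *: z + x0) = t * f z + f x0 by rewrite linearD linearZ.
rewrite raddfD/= ReMl// normrZ exprMn real_normK// -subr_ge0.
have -> : 'Re (hdot H z x0) = c + 'Re (f z) by rewrite /c raddfB/= subrK.
rewrite (_ : _ - _ = - (c / d) ^+ 2 * (d + 1)); last first.
  rewrite /t (_ : `|z| ^+ 2 = d - 1) ?/d ?addrK//.
  by field; rewrite gt_eqF.
rewrite mulNr oppr_ge0 => h; apply/eqP; move: h.
rewrite pmulr_lle0; last by rewrite addr_gt0.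
rewrite real_exprn_even_le0//=.
  by rewrite mulf_eq0 invr_eq0 (gt_eqF d0) orbF.
by rewrite rpredM// rpredV gtr0_real.
Qed.

Lemma riesz : exists y : H, forall x, f x = hdot H x y.
Proof.
exists x0 => x; apply/eqP; rewrite eq_sym -subr_eq0; apply/eqP.
rewrite [LHS]Crect re0 add0r.
have := re0 ('i *: x).
have -> : f ('i *: x) = 'i * f x by rewrite linearZ.
have -> : hdot H ('i *: x) x0 = 'i * hdot H x x0 by exact: hdotZl.
by rewrite -mulrBr ReMil => /eqP; rewrite oppr_eq0 => /eqP ->; rewrite mulr0.
Qed.
End Riesz.

Lemma hilbert_cs H (x y : H) : `|hdot H x y| <= `|x| * `|y|.
Proof.
have [->|y0] := eqVneq y 0.
  by rewrite -(scale0r (0 : H)) hdotZr rmorph0 mul0r scale0r !normr0 mulr0.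
have d0 : 0 < `|y| ^+ 2 by rewrite exprn_gt0// normr_gt0.
set d := `|y| ^+ 2 in d0; set w := hdot H x y.
have : 0 <= `|d *: x + (- w) *: y| ^+ 2 by exact: exprn_ge0.
have dx : `|d *: x| = d * `|x| by rewrite normrZ (ger0_norm (ltW d0)).
rewrite hnormDE dx normrZ normrN [(d * _) ^+ 2]exprMn [(`|w| * _) ^+ 2]exprMn -/d.
have -> : hdot H (d *: x) ((- w) *: y) = - (d * `|w| ^+ 2).
  by rewrite hdotZr hdotZl -/w rmorphN/= mulNr mulrCA (mulrC w^*) -normCK.
rewrite raddfN/= (Creal_ReP _ (_ : d * `|w| ^+ 2 \is Num.real)); last first.
  by rewrite rpredM ?rpredX ?normr_real ?gtr0_real.
rewrite (_ : _ + _ + _ = d * (d * `|x| ^+ 2 - `|w| ^+ 2)); last by ring.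
rewrite pmulr_rge0// subr_ge0 /d -exprMn (mulrC `|y|).
by rewrite ler_pXn2r// nnegrE// mulr_ge0.
Qed.

Lemma adjoint_exists H K (T : bop H K) :
  exists T' : bop K H, forall x y, hdot K (T x) y = hdot H x (T' y).
Proof.
have [M M0 TM] := bop_bounded T.
have rz y : exists z : H, forall x, hdot K (T x) y = hdot H x z.
  have lin : linear (fun x => hdot K (T x) y : R[i]^o).
    by move=> a u v; rewrite linearP hdotDl hdotZl.
  pose f : {linear H -> R[i]^o} := HB.pack (fun x => hdot K (T x) y : R[i]^o)
    (GRing.isLinear.Build _ _ _ _ (fun x => hdot K (T x) y : R[i]^o) lin).
  have M1 : 0 < M * (`|y| + 1) by rewrite mulr_gt0// ltr_wpDl.
  apply: (@riesz H f _ M1) => x /=.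
  apply: le_trans (hilbert_cs _ _) _.
  rewrite mulrAC ler_pM// ?mulr_ge0// ?(ltW M0)// lerDl.
  by [].
have /choice [g gE] := rz.
have dot_inj u v : (forall x, hdot H x u = hdot H x v) -> u = v.
  move=> h; apply/eqP; rewrite -subr_eq0 -normr_eq0 -sqrf_eq0 hnormE.
  by rewrite hdotDr -scaleN1r hdotZr h rmorphN rmorph1 mulN1r subrr.
have glin : linear g.
  move=> a u v; apply: dot_inj => x.
  by rewrite -gE !(hdotDr, hdotZr) !gE.
pose G : {linear K -> H} := HB.pack g (GRing.isLinear.Build _ _ _ _ g glin).
have GM y : `|G y| <= M * `|y|.
  have [->|gy0] := eqVneq (G y) 0; first by rewrite normr0 mulr_ge0// ltW.
  have gp : 0 < `|G y| by rewrite normr_gt0.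
  rewrite -(ler_pM2l gp) -expr2 hnormE -gE.
  rewrite -[leLHS]ger0_norm ?gE -?hnormE ?exprn_ge0//.
  rewrite hnormE -gE; apply: le_trans (hilbert_cs _ _) _.
  by rewrite mulrA (mulrC `|G y|) ler_wpM2r.
by exists (Bop (bounded_bop GM)) => x y; rewrite gE.
Qed.

Definition adj H K (T : bop H K) : bop K H := projT1 (cid (adjoint_exists T)).

Lemma adjP H K (T : bop H K) x y : '<T x, y> = '<x, adj T y>.
Proof. by rewrite /adj; case: cid. Qed.

Definition is_isometry H K (T : bop H K) := forall x, `|T x| = `|x|.

Definition is_unitary H (T : bop H H) :=
  (forall x, adj T (T x) = x) /\ (forall x, T (adj T x) = x).

Definition is_projection H (P : bop H H) :=
  (forall x, P (P x) = P x) /\ (forall x, adj P x = P x).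

(* The order on R[i] makes [0 <= z] mean that z is real and nonnegative. *)
Definition bop_le H (f g : H -> H) := forall x, 0 <= '<g x - f x, x>.

(* The operator matrix (a i j), acting on the Hilbert sum of n copies of H,
   has norm at most M. *)
Definition mx_norm_le H n (a : 'I_n -> 'I_n -> bop H H) (M : R[i]) :=
  forall x : 'I_n -> H,
    \sum_i `|\sum_j a i j (x j)| ^+ 2 <= M ^+ 2 * \sum_j `|x j| ^+ 2.

End Operators.

Record digraph := Digraph {
  vert : finType;
  edge : finType;
  rg : edge -> vert;
  src : edge -> vert }.

Definition source_free (E : digraph) :=
  forall v : vert E, exists e : edge E, rg e = v.

(* A bijection of the disjoint union of vertices and edges preserving both
   parts is a pair of permutations. *)
Record graph_aut (E : digraph) := GraphAut {
  autv : {perm vert E};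
  aute : {perm edge E};
  aut_rg : forall e, rg (aute e) = autv (rg e);
  aut_src : forall e, src (aute e) = autv (src e) }.

Definition aut_fun E (g : graph_aut E) (m : vert E + edge E) :
    vert E + edge E :=
  match m with inl v => inl (autv g v) | inr e => inr (aute g e) end.

Record self_similar (E : digraph) := SelfSimilar {
  ss_aut : nat -> graph_aut E;
  ss_res : nat -> vert E + edge E -> nat;
  ss_autD : forall p q m,
    aut_fun (ss_aut (p + q)%N) m = aut_fun (ss_aut p) (aut_fun (ss_aut q) m);
  ss_resD : forall p q m,
    ss_res (p + q)%N m = (ss_res p (aut_fun (ss_aut q) m) + ss_res q m)%N;
  ss_resv : forall p v, ss_res p (inl v) = p;
  ss_res0 : forall e, ss_res 0%N (inr e) = 0%N;
  ss_res_src : forall p e v, src e = v ->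
    aut_fun (ss_aut (ss_res p (inr e))) (inl v) = aut_fun (ss_aut p) (inl v) }.

Definition ss_act E (X : self_similar E) (p : nat) := aut_fun (ss_aut X p).

(* Finite paths: a vertex, or a nonempty composable list of edges. *)
Inductive fpath (E : digraph) : Type :=
  | PVert of vert E
  | PEdges (e : edge E) (es : seq (edge E))
      of path (fun f g => src f == rg g) e es.

Section Families.
Variables (R : realType) (E : digraph) (H : hilbert R).
Variable S : vert E + edge E -> bop H H.

Record is_TCK : Prop := IsTCK {
  tck_proj : forall v, is_projection (S (inl v));
  tck_orth : forall v w, v != w -> forall x, S (inl v) (S (inl w) x) = 0;
  tck_init : forall e x, adj (S (inr e)) (S (inr e) x) = S (inl (src e)) x;
  tck_range : forall v,
    bop_le (fun x => \sum_(e | rg e == v) S (inr e) (adj (S (inr e)) x))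
           (S (inl v));
  tck_nondeg : forall x, \sum_v S (inl v) x = x }.

Definition is_CK : Prop := is_TCK /\
  forall v x, \sum_(e | rg e == v) S (inr e) (adj (S (inr e)) x) = S (inl v) x.

Fixpoint S_edges (e : edge E) (es : seq (edge E)) : bop H H :=
  if es is f :: es' then bop_comp (S (inr e)) (S_edges f es') else S (inr e).

Definition S_path (mu : fpath E) : bop H H :=
  match mu with
  | PVert v => S (inl v)
  | PEdges e es _ => S_edges e es
  end.

End Families.

Record toeplitz_rep (R : realType) (E : digraph) (X : self_similar E) :=
    ToeplitzRep {
  trep_space :> hilbert R;
  trepV : nat -> bop trep_space trep_space;
  trepS : vert E + edge E -> bop trep_space trep_space;
  trepV_isometry : forall p, is_isometry (trepV p);
  trepVD : forall p q x, trepV p (trepV q x) = trepV (p + q)%N x;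
  trepV0 : forall x, trepV 0%N x = x;
  trepS_TCK : is_TCK trepS;
  trep_VS : forall p m x,
    trepV p (trepS m x) = trepS (ss_act X p m) (trepV (ss_res X p m) x);
  trep_VadjS : forall p m x,
    adj (trepV p) (trepS (ss_act X p m) x)
    = trepS m (adj (trepV (ss_res X p m)) x) }.

Definition unitary_CK R E (X : self_similar E) (T : toeplitz_rep R X) :=
  is_unitary (trepV T 1%N) /\ is_CK (trepS T).

Section Algebra.
Variables (R : realType) (E : digraph) (X : self_similar E).

(* The direct sum of all Toeplitz representations is too large to be a
   [hilbert R].  The operators of interest on it are block diagonal, so they are
   given by their families of blocks; the norm of a family (or of a matrix of
   families) is the supremum of the norms of its blocks, so M bounds it exactly
   when M bounds the norm of every block. *)
Definition family := forall T : toeplitz_rep R X, bop T T.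

Definition fam_gen (mu : fpath E) (p : nat) : family :=
  fun T => bop_comp (S_path (trepS T) mu) (trepV T p).
Definition fam0 : family := fun T => bop0 T T.
Definition fam_add (a b : family) : family := fun T => bop_add (a T) (b T).
Definition fam_scale (c : R[i]) (a : family) : family :=
  fun T => bop_scale c (a T).
Definition fam_mul (a b : family) : family := fun T => bop_comp (a T) (b T).

Record closed_subalgebra (B : family -> Prop) : Prop := ClosedSubalgebra {
  csa0 : B fam0;
  csaD : forall a b, B a -> B b -> B (fam_add a b);
  csaZ : forall c a, B a -> B (fam_scale c a);
  csaM : forall a b, B a -> B b -> B (fam_mul a b);
  csa_closed : forall a : family,
    (forall eps : R[i], 0 < eps -> exists2 b, B b &
      forall (T : toeplitz_rep R X) x, `|a T x - b T x| <= eps * `|x|) ->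
    B a }.

(* The smallest norm-closed algebra containing all the S_mu V_p. *)
Definition opalg (a : family) : Prop := forall B : family -> Prop,
  closed_subalgebra B -> (forall mu p, B (fam_gen mu p)) -> B a.

(* Only the values on [opalg] are meaningful.  The last clause says that every
   norm bound for a matrix over [opalg] is a norm bound for its image, that is,
   all the matrix amplifications are contractive. *)
Record is_ccrep (H : hilbert R) (rho : family -> bop H H) : Prop := IsCCRep {
  ccrepD : forall a b, opalg a -> opalg b ->
    forall x, rho (fam_add a b) x = rho a x + rho b x;
  ccrepZ : forall c a, opalg a -> forall x, rho (fam_scale c a) x = c *: rho a x;
  ccrepM : forall a b, opalg a -> opalg b ->
    forall x, rho (fam_mul a b) x = rho a (rho b x);
  ccrep_cc : forall n (a : 'I_n -> 'I_n -> family) (M : R[i]), 0 <= M ->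
    (forall i j, opalg (a i j)) ->
    (forall T : toeplitz_rep R X, mx_norm_le (fun i j => a i j T) M) ->
    mx_norm_le (fun i j => rho (a i j)) M }.

Record ccrep := CCRep {
  cc_space :> hilbert R;
  cc_fun : family -> bop cc_space cc_space;
  cc_prop : is_ccrep cc_fun }.

(* A Toeplitz representation, as the compression to its own summand. *)
Lemma toeplitz_is_ccrep (T : toeplitz_rep R X) :
  is_ccrep (fun a : family => a T).
Proof. by split=> // n a M _ _ aM; exact: aM. Qed.

Definition ccrep_of (T : toeplitz_rep R X) : ccrep :=
  CCRep (toeplitz_is_ccrep T).

(* H is regarded as a subspace of K through the isometry J; then J^* T J is the
   compression P_H T |_H of an operator T on K. *)
Definition is_dilation (rho pi : ccrep) (J : bop rho pi) :=
  is_isometry J /\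
  forall a, opalg a -> forall x, cc_fun rho a x = adj J (cc_fun pi a (J x)).

(* pi = rho (+) sigma, for J : H -> K the given embedding and K = J H (+) J' L. *)
Definition is_direct_sum (rho sigma pi : ccrep) (J : bop rho pi)
    (J' : bop sigma pi) :=
  [/\ is_isometry J, is_isometry J',
      forall x y, '<J x, J' y> = 0,
      forall k, exists x y, k = J x + J' y &
      forall a, opalg a -> forall x y,
        cc_fun pi a (J x + J' y) = J (cc_fun rho a x) + J' (cc_fun sigma a y)].

Definition maximal (rho : ccrep) := forall (pi : ccrep) (J : bop rho pi),
  is_dilation J ->
  exists (sigma : ccrep) (J' : bop sigma pi), is_direct_sum J J'.

End Algebra.

(* Main.v *)
(* Let J : H -> K be a dilation of T.  The compression J^* k of a vector k has
   norm at most |k|, with equality only if k lies in J H.  Hence if a_1, ..., a_n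
   in the algebra form a column contraction in every Toeplitz representation and
   an isometric column in T, then pi(a_i) J = J a_i; dually, if they form a row
   contraction whose adjoint is isometric in T, then J^* pi(a_i) = a_i J^*.  The
   column case applies to V_1, to (S_v)_v and, together with the S_v for
   v <> s(e), to S_e.  The row case applies to V_1 because it is unitary, to
   (S_v)_v, and to (S_e)_e because sum_e S_e S_e^* = I is the Cuntz-Krieger
   relation.  So J H reduces the image of every generator, hence of the algebra,
   and the kernel of J^* carries the complementary summand. *)
From HB Require Import structures.
Require Import Defs.
From mathcomp Require Import all_boot all_order all_algebra.
From mathcomp Require Import all_classical all_reals all_analysis.
From mathcomp Require Import sesquilinear complex ring.

Set Implicit Arguments.
Unset Strict Implicit.
Unset Printing Implicit Defensive.

Import Order.TTheory GRing.Theory Num.Theory.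
Import numFieldNormedType.Exports.

Local Open Scope classical_set_scope.
Local Open Scope ring_scope.

Lemma sum_enum_val (V : nmodType) (I : finType) (F : I -> V) :
  \sum_i F i = \sum_(i < #|I|) F (enum_val i).
Proof. by rewrite -big_enum_val; apply: eq_bigl => i; rewrite inE. Qed.

Section Kernel.
Variables (R : realType) (H K : hilbert R) (F : bop K H).

Definition ker_pred : {pred K} := [pred x | F x == 0].

Record kernel := Kernel { kernel_val : K; _ : kernel_val \in ker_pred }.

HB.instance Definition _ := [isSub for kernel_val].
HB.instance Definition _ := [Choice of kernel by <:].

Lemma ker_submod_closed : submod_closed ker_pred.
Proof.
split=> [|a x y]; rewrite !inE ?linear0// => /eqP Fx /eqP Fy.
by rewrite linearP Fx Fy scaler0 addr0.
Qed.

HB.instance Definition _ := GRing.isSubmodClosed.Build _ _ ker_pred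
  ker_submod_closed.
HB.instance Definition _ := [SubChoice_isSubLmodule of kernel by <:].

Definition kernel_norm (x : kernel) : R[i] := `|kernel_val x|.

Lemma kernel_normD x y : kernel_norm (x + y) <= kernel_norm x + kernel_norm y.
Proof. exact: ler_normD. Qed.

Lemma kernel_normZ (c : R[i]) x : kernel_norm (c *: x) = `|c| * kernel_norm x.
Proof. exact: normrZ. Qed.

Lemma kernel_norm0_eq0 x : kernel_norm x = 0 -> x = 0.
Proof. by move/normr0_eq0 => x0; apply: val_inj. Qed.

HB.instance Definition _ := @Lmodule_isNormed.Build R[i] kernel kernel_norm
  kernel_normD kernel_normZ kernel_norm0_eq0.

Lemma kernel_cauchy_cvg (G : set_system kernel) :
  ProperFilter G -> cauchy G -> cvg G.
Proof.
move=> PG /cauchy_ballP cG.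
have cK : cvg ((kernel_val x : K) @[x --> G]).
  apply/cauchy_cvgP/cauchy_ballP => e e0.
  have [[A B] /= [GA GB] AB] := cG e e0.
  exists (kernel_val @` A, kernel_val @` B) => /=.
    split; [apply: filterS GA | apply: filterS GB] => x xA;
      exact: imageP.
  move=> [_ _] [/= [x Ax <-] [y By <-]].
  by have := AB (x, y) (conj Ax By); rewrite -!ball_normE.
pose l := lim ((kernel_val x : K) @[x --> G]).
have Fl : l \in ker_pred.
  rewrite inE; apply/eqP.
  apply: (@cvg_unique _ _ ((F (kernel_val x)) @[x --> G])).
  - exact: norm_hausdorff.
  - by apply: continuous_cvg => //; exact: bop_cont.
  - rewrite (_ : (fun x => F (kernel_val x)) = fun=> 0); first exact: cvg_cst.
    by apply/funext => -[x /= /eqP].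
apply/cvg_ex; exists (Kernel Fl).
apply/cvgrPdist_lt => e e0.
exact: (@cvgr_dist_lt _ _ _ _ _ _ _ cK e e0).
Qed.

HB.instance Definition _ := Uniform_isComplete.Build kernel kernel_cauchy_cvg.

End Kernel.

Section KernelHilbert.
Variables (R : realType) (H K : hilbert R) (F : bop K H).

Definition kernel_dot (x y : kernel F) : R[i] :=
  '<kernel_val x, kernel_val y>.

Lemma kernel_valP (a : R[i]) (x y : kernel F) :
  kernel_val (a *: x + y) = a *: kernel_val x + kernel_val y.
Proof. by []. Qed.

Lemma kernel_dot_bilinear :
  bilinear_for *%R (Num.conj \; *%R) kernel_dot.
Proof.
split=> [u a x y|u a x y]; rewrite /kernel_dot kernel_valP.
  by rewrite hdotDl hdotZl.
by rewrite hdotDr hdotZr.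
Qed.

HB.instance Definition _ := @bilinear_isBilinear.Build R[i] (kernel F)
  (kernel F) R[i] *%R (Num.conj \; *%R) kernel_dot kernel_dot_bilinear.

Lemma kernel_dot_hermitian x y :
  kernel_dot x y = (-1) ^+ false * (kernel_dot y x)^*.
Proof. by rewrite expr0 mul1r /kernel_dot hdotC. Qed.

HB.instance Definition _ := @isHermitianSesquilinear.Build R[i] (kernel F)
  false Num.conj kernel_dot kernel_dot_hermitian.

Lemma kernel_dot_gt0 x : x != 0 -> 0 < kernel_dot x x.
Proof. by move=> x0; rewrite /kernel_dot -hnormE exprn_gt0// normr_gt0. Qed.

HB.instance Definition _ := @isDotProduct.Build R[i] (kernel F) kernel_dot
  kernel_dot_gt0.

Definition kernel_hilbert : hilbert R :=
  @Hilbert R (kernel F) kernel_dot (fun x => hnormE (kernel_val x)).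

Definition kernel_inj (x : kernel_hilbert) : K := kernel_val x.

Lemma kernel_inj_linear : linear kernel_inj.
Proof. by []. Qed.

HB.instance Definition _ := GRing.isLinear.Build R[i] kernel_hilbert K _
  kernel_inj kernel_inj_linear.

Lemma kernel_inj_continuous : continuous kernel_inj.
Proof. by apply: (@bounded_bop _ kernel_hilbert K _ 1) => x; rewrite mul1r. Qed.

Definition kernel_incl : bop kernel_hilbert K := Bop kernel_inj_continuous.

Lemma kernel_incl_isometry : is_isometry kernel_incl.
Proof. by []. Qed.

Lemma kernel_inclK x : F (kernel_incl x) = 0.
Proof. by case: x => x /= /eqP. Qed.

Lemma kernel_inclP k : F k = 0 -> exists y, k = kernel_incl y.
Proof. by move/eqP => Fk; exists (Kernel Fk). Qed.

End KernelHilbert.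

Section Operators.
Variable R : realType.
Implicit Types H K : hilbert R.

Lemma hdot_suml H (I : finType) (F : I -> H) y :
  '<\sum_i F i, y> = \sum_i '<F i, y>.
Proof.
by apply: (big_morph (fun x => hdot H x y)) => [u v|];
  rewrite ?hdotDl ?linear0l.
Qed.

Lemma hdot_injr H (u v : H) : (forall x, '<x, u> = '<x, v>) -> u = v.
Proof.
move=> uv; apply/eqP; rewrite -subr_eq0 -normr_eq0 -sqrf_eq0 hnormE.
by rewrite hdotDr -scaleN1r hdotZr uv rmorphN rmorph1 mulN1r subrr.
Qed.

Lemma hnormBE H (x y : H) :
  `|x - y| ^+ 2 = `|x| ^+ 2 + `|y| ^+ 2 - 2 * 'Re '<x, y>.
Proof.
by rewrite hnormDE normrN -scaleN1r hdotZr rmorphN rmorph1 mulN1r raddfN mulrN.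
Qed.

Lemma adjPr H K (T : bop H K) x y : '<y, T x> = '<adj T y, x>.
Proof. by rewrite hdotC adjP -hdotC. Qed.

Lemma Re_hdotxx H (x : H) : 'Re '<x, x> = `|x| ^+ 2.
Proof. by rewrite -hnormE; apply/Creal_ReP; rewrite rpredX// normr_real. Qed.

Lemma isometry_hdot H K (J : bop H K) : is_isometry J ->
  forall x y, '<J x, J y> = '<x, y>.
Proof.
move=> Jiso.
have JRe x y : 'Re '<J x, J y> = 'Re '<x, y>.
  have := hnormDE (J x) (J y); rewrite -linearD !Jiso hnormDE.
  by move/addrI/mulfI => -> //; rewrite pnatr_eq0.
move=> x y; rewrite [LHS]Crect [RHS]Crect JRe; congr (_ + 'i * _).
have := JRe ('i *: x) y; rewrite linearZ !hdotZl !ReMil.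
exact: oppr_inj.
Qed.

Lemma isometryK H K (J : bop H K) : is_isometry J -> forall x, adj J (J x) = x.
Proof.
by move=> Jiso x; apply: hdot_injr => y; rewrite -adjP isometry_hdot.
Qed.

Lemma isometry_defect H K (J : bop H K) : is_isometry J ->
  forall k, `|k - J (adj J k)| ^+ 2 = `|k| ^+ 2 - `|adj J k| ^+ 2.
Proof.
move=> Jiso k; rewrite hnormBE Jiso (adjPr J) Re_hdotxx; ring.
Qed.

Lemma adj_isometry_le H K (J : bop H K) : is_isometry J ->
  forall k, `|adj J k| ^+ 2 <= `|k| ^+ 2.
Proof.
by move=> Jiso k; rewrite -subr_ge0 -isometry_defect// exprn_ge0.
Qed.

Lemma row_contraction_adj H K (I : finType) (A : I -> bop H K) :
  (forall x : I -> H, `|\sum_i A i (x i)| ^+ 2 <= \sum_i `|x i| ^+ 2) ->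
  forall y, \sum_i `|adj (A i) y| ^+ 2 <= `|y| ^+ 2.
Proof.
move=> Arow y; set s := \sum_i _; set z := \sum_i A i (adj (A i) y).
have : 0 <= `|z - y| ^+ 2 by rewrite exprn_ge0.
rewrite hnormBE.
have -> : 'Re '<z, y> = s.
  rewrite hdot_suml raddf_sum; apply: eq_bigr => i _.
  by rewrite /= adjP Re_hdotxx.
have := Arow (fun i => adj (A i) y); rewrite -/z -/s => zs h.
rewrite -subr_ge0; apply: le_trans h _; rewrite -subr_ge0.
by rewrite (_ : _ - _ = s - `|z| ^+ 2) ?subr_ge0//; ring.
Qed.

Lemma adj_row_contraction H K (I : finType) (A : I -> bop H K) :
  (forall y, \sum_i `|adj (A i) y| ^+ 2 <= `|y| ^+ 2) ->
  forall x : I -> H, `|\sum_i A i (x i)| ^+ 2 <= \sum_i `|x i| ^+ 2.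
Proof.
move=> Aadj x; set s := \sum_i `|_| ^+ 2; set z := \sum_i _.
have : 0 <= \sum_i `|x i - adj (A i) z| ^+ 2.
  by apply: sumr_ge0 => i _; rewrite exprn_ge0.
under eq_bigr do rewrite hnormBE -adjP.
have Re_z : \sum_i 'Re '<A i (x i), z> = `|z| ^+ 2.
  by rewrite -Re_hdotxx {2}/z hdot_suml raddf_sum.
rewrite sumrB big_split /= -mulr_sumr Re_z -/s.
have := Aadj z; move: (\sum_i _) => t tz h.
rewrite -subr_ge0; apply: le_trans h _; rewrite -subr_ge0.
by rewrite (_ : _ - _ = `|z| ^+ 2 - t) ?subr_ge0//; ring.
Qed.

Lemma eq_sumr_le (I : finType) (f g : I -> R[i]) :
  (forall i, f i <= g i) -> \sum_i g i <= \sum_i f i -> forall i, g i <= f i.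
Proof.
move=> fg gf i; have := gf.
rewrite (bigD1 i)//= [leRHS](bigD1 i)//= => h.
rewrite -(lerD2r (\sum_(j | j != i) g j)); apply: le_trans h _.
by rewrite lerD2l; exact: ler_sum.
Qed.

Lemma isometry_range_tight H K (J : bop H K) (I : finType) (k : I -> K) M :
  is_isometry J -> \sum_i `|k i| ^+ 2 <= M ->
  \sum_i `|adj J (k i)| ^+ 2 = M -> forall i, k i = J (adj J (k i)).
Proof.
move=> Jiso kM MJ i; apply/eqP; rewrite -subr_eq0 -normr_eq0 -sqrf_eq0.
rewrite eq_le exprn_ge0// andbT isometry_defect// subr_le0.
by apply: (eq_sumr_le (fun i => adj_isometry_le Jiso (k i))); rewrite MJ.
Qed.

Lemma norm_small0 H (u : H) (M : R[i]) : 0 <= M ->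
  (forall e : R[i], 0 < e -> `|u| <= e * M) -> u = 0.
Proof.
move=> M0 uM; apply/eqP; rewrite -normr_eq0; apply/negPn/negP => u0.
have up : 0 < `|u| by rewrite lt_neqAle eq_sym u0 /=.
have M1 : 0 < M + 1 by rewrite ltr_wpDl.
have := uM _ (divr_gt0 up M1).
rewrite mulrAC ler_pdivlMr// ler_pM2l// gerDl.
by rewrite real_leNgt ?real1// ltr01.
Qed.

End Operators.

Section TCKNorms.
Variables (R : realType) (E : digraph) (H : hilbert R).
Variable S : vert E + edge E -> bop H H.
Hypothesis tckS : is_TCK S.

Lemma tck_vertex_hdot v x : '<S (inl v) x, x> = `|S (inl v) x| ^+ 2.
Proof.
have [SS Sadj] := tck_proj tckS v.
by rewrite hnormE (adjPr (S (inl v))) Sadj SS.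
Qed.

Lemma tck_vertex_norm x : \sum_v `|S (inl v) x| ^+ 2 = `|x| ^+ 2.
Proof.
have := hdot_suml (fun v => S (inl v) x) x.
rewrite (tck_nondeg tckS) -hnormE => ->.
by apply: eq_bigr => v _; rewrite tck_vertex_hdot.
Qed.

Lemma tck_edge_norm e x : `|S (inr e) x| ^+ 2 = `|S (inl (src e)) x| ^+ 2.
Proof. by rewrite hnormE adjPr (tck_init tckS) tck_vertex_hdot. Qed.

Lemma tck_range_hdot v y :
  '<\sum_(e | rg e == v) S (inr e) (adj (S (inr e)) y), y> =
  \sum_(e | rg e == v) `|adj (S (inr e)) y| ^+ 2.
Proof.
rewrite big_mkcond hdot_suml [RHS]big_mkcond; apply: eq_bigr => e _.
by case: ifP; rewrite ?linear0l// adjP hnormE.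
Qed.

Lemma tck_edge_adj_norm y : \sum_e `|adj (S (inr e)) y| ^+ 2 <= `|y| ^+ 2.
Proof.
rewrite (partition_big (@rg E) predT)//= -tck_vertex_norm.
apply: ler_sum => v _; rewrite -tck_range_hdot -tck_vertex_hdot -subr_ge0.
have := tck_range tckS v y; rewrite hdotDl -scaleN1r hdotZl mulN1r.
exact.
Qed.

Lemma ck_edge_adj_norm y : is_CK S ->
  \sum_e `|adj (S (inr e)) y| ^+ 2 = `|y| ^+ 2.
Proof.
move=> [_ ckS]; rewrite (partition_big (@rg E) predT)//= -tck_vertex_norm.
by apply: eq_bigr => v _; rewrite -tck_range_hdot ckS tck_vertex_hdot.
Qed.

End TCKNorms.

Section OperatorAlgebra.
Variables (R : realType) (E : digraph) (X : self_similar E).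
Local Notation family := (Defs.family R X).
Implicit Types (a b : family) (B : family -> Prop).

Definition fam_S (m : vert E + edge E) : family := fun T => trepS T m.
Definition fam_V (p : nat) : family := fun T => trepV T p.
Definition fam_sum (I : finType) (a : I -> family) : family :=
  \big[@fam_add R E X/fam0 (X := X)]_i a i.

Lemma fam_sumE (I : finType) (a : I -> family) (T : toeplitz_rep R X) x :
  fam_sum a T x = \sum_i a i T x.
Proof.
by apply: (big_morph (fun b : family => b T x)).
Qed.

Lemma csa_sum B (I : finType) (a : I -> family) : closed_subalgebra B ->
  (forall i, B (a i)) -> B (fam_sum a).
Proof.
by move=> csB Ba; apply: (big_ind B) => //; [exact: csa0|exact: csaD].
Qed.

Lemma csa_ext B a b : closed_subalgebra B ->
  (forall (T : toeplitz_rep R X) x, a T x = b T x) -> B b -> B a.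
Proof.
move=> csB ab Bb; apply: (csa_closed csB) => e e0; exists b => // T x.
by rewrite ab subrr normr0 mulr_ge0// ltW.
Qed.

Lemma csa_gen B : closed_subalgebra B -> (forall m, B (fam_S m)) ->
  B (fam_V 1) -> forall mu p, B (@fam_gen R E X mu p).
Proof.
move=> csB BS BV mu p.
apply: (@csaM _ _ _ B csB (fun T => S_path (trepS T) mu)).
  case: mu => [v|e es /= _]; first exact: BS.
  elim: es e => [|f es IH] e; first exact: BS.
  exact: (csaM csB (BS _) (IH f)).
elim: p => [|p IH].
  apply: (csa_ext csB (b := fam_sum (fun v => fam_S (inl v)))) => [T x|].
    by rewrite fam_sumE trepV0 (tck_nondeg (trepS_TCK T)).
  exact: csa_sum.
apply: (csa_ext csB (b := fam_mul (fam_V 1) (fam_V p))) => [T x|].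
  by rewrite /= trepVD.
exact: csaM.
Qed.

Lemma opalg_csa : closed_subalgebra (@opalg R E X).
Proof.
split.
- by move=> B csB _; exact: csa0.
- by move=> a b Aa Ab B csB Bg; apply: csaD => //; [exact: Aa|exact: Ab].
- by move=> c a Aa B csB Bg; apply: csaZ => //; exact: Aa.
- by move=> a b Aa Ab B csB Bg; apply: csaM => //; [exact: Aa|exact: Ab].
- move=> a Aa B csB Bg; apply: (csa_closed csB) => e e0.
  by have [b Ab ab] := Aa e e0; exists b => //; exact: Ab.
Qed.

Lemma opalg_gen mu p : opalg (@fam_gen R E X mu p).
Proof. by move=> B _; apply. Qed.

Lemma opalg_S m : opalg (fam_S m).
Proof.
apply: (csa_ext opalg_csa _ (opalg_gen
  (match m with inl v => PVert v | inr e => @PEdges E e [::] isT end) 0)).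
by move=> T x; rewrite /= trepV0; case: m.
Qed.

Lemma opalg_V p : opalg (fam_V p).
Proof.
apply: (csa_ext opalg_csa (b := fam_sum (fun v => @fam_gen R E X (PVert v) p))).
  by move=> T x; rewrite fam_sumE /= (tck_nondeg (trepS_TCK T)).
by apply: csa_sum => [|v]; [exact: opalg_csa|exact: opalg_gen].
Qed.

Section CompletelyContractive.
Variable pi : ccrep R X.

Lemma ccrep_norm a M : opalg a -> 0 <= M ->
  (forall (T : toeplitz_rep R X) x, `|a T x| <= M * `|x|) ->
  forall k, `|cc_fun pi a k| <= M * `|k|.
Proof.
move=> Aa M0 aM k.
have := ccrep_cc (cc_prop pi) (n := 1) (a := fun _ _ => a) M0.
move=> /(_ (fun _ _ => Aa)) h.
have /h/(_ (fun=> k)) : forall T : toeplitz_rep R X,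
    mx_norm_le (fun _ _ : 'I_1 => a T) M.
  move=> T x; rewrite !big_ord1 -exprMn ler_pXn2r// nnegrE//.
  by rewrite mulr_ge0.
by rewrite !big_ord1 -exprMn ler_pXn2r// nnegrE// mulr_ge0.
Qed.

Lemma ccrepB a b : opalg a -> opalg b ->
  opalg (fam_add a (fam_scale (-1) b)) /\
  forall k, cc_fun pi (fam_add a (fam_scale (-1) b)) k =
            cc_fun pi a k - cc_fun pi b k.
Proof.
move=> Aa Ab.
have Ab' : opalg (fam_scale (-1) b) by apply: csaZ opalg_csa _ _ _.
split=> [|k]; first exact: csaD opalg_csa _ _ _ _.
by rewrite (ccrepD (cc_prop pi))// (ccrepZ (cc_prop pi))// scaleN1r.
Qed.

Lemma ccrep_dist a b M : opalg a -> opalg b -> 0 <= M ->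
  (forall (T : toeplitz_rep R X) x, `|a T x - b T x| <= M * `|x|) ->
  forall k, `|cc_fun pi a k - cc_fun pi b k| <= M * `|k|.
Proof.
move=> Aa Ab M0 abM k; have [Aab <-] := ccrepB Aa Ab.
by apply: ccrep_norm => // T x; rewrite /= scaleN1r.
Qed.

Lemma ccrep_column (I : finType) (a : I -> family) :
  (forall i, opalg (a i)) ->
  (forall (T : toeplitz_rep R X) x, \sum_i `|a i T x| ^+ 2 <= `|x| ^+ 2) ->
  forall k, \sum_i `|cc_fun pi (a i) k| ^+ 2 <= `|k| ^+ 2.
Proof.
move=> Aa acol k.
have [i0 _|I0] := pickP (xpredT : pred I); last first.
  by rewrite big_pred0// exprn_ge0.
pose a' (i j : 'I_#|I|) := if j == enum_rank i0
    then a (enum_val i) else fam0 (X := X).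
have colE (K : hilbert R) (f : family -> bop K K) (x : 'I_#|I| -> K) :
    (forall j, j != enum_rank i0 -> forall i, f (a' i j) (x j) = 0) ->
    \sum_i `|\sum_j f (a' i j) (x j)| ^+ 2 =
    \sum_i `|f (a i) (x (enum_rank i0))| ^+ 2.
  move=> f0; rewrite [RHS]sum_enum_val; apply: eq_bigr => i _.
  rewrite (bigD1 (enum_rank i0))//= big1 ?addr0; last by move=> j /f0 ->.
  by rewrite /a' eqxx.
have A' i j : opalg (a' i j).
  by rewrite /a'; case: ifP => // _; exact: csa0 opalg_csa.
have h := ccrep_cc (cc_prop pi) ler01 A'.
have /h/(_ (fun j => if j == enum_rank i0 then k else 0)) :
    forall T : toeplitz_rep R X, mx_norm_le (fun i j => a' i j T) 1.
  move=> T x; rewrite expr1n mul1r (colE T (fun b => b T)); last first.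
    by move=> j j0 i; rewrite /a' (negbTE j0).
  apply: le_trans (acol T _) _.
  by rewrite [leRHS](bigD1 (enum_rank i0))//= lerDl sumr_ge0.
rewrite colE; last by move=> j /negbTE -> i; rewrite linear0.
rewrite eqxx expr1n mul1r [leRHS](bigD1 (enum_rank i0))//= eqxx.
rewrite [X in _ + X]big1 ?addr0// => j /negbTE ->.
by rewrite normr0 expr0n.
Qed.

Lemma ccrep_row (I : finType) (a : I -> family) :
  (forall i, opalg (a i)) ->
  (forall (T : toeplitz_rep R X) (x : I -> T),
    `|\sum_i a i T (x i)| ^+ 2 <= \sum_i `|x i| ^+ 2) ->
  forall k : I -> pi,
    `|\sum_i cc_fun pi (a i) (k i)| ^+ 2 <= \sum_i `|k i| ^+ 2.
Proof.
move=> Aa arow k.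
have [i0 _|I0] := pickP (xpredT : pred I); last first.
  by rewrite big_pred0// normr0 expr0n sumr_ge0// => i _; rewrite exprn_ge0.
pose a' (i j : 'I_#|I|) := if i == enum_rank i0
    then a (enum_val j) else fam0 (X := X).
have A' i j : opalg (a' i j).
  by rewrite /a'; case: ifP => // _; exact: csa0 opalg_csa.
have h := ccrep_cc (cc_prop pi) ler01 A'.
have /h/(_ (fun j => k (enum_val j))) :
    forall T : toeplitz_rep R X, mx_norm_le (fun i j => a' i j T) 1.
  move=> T x; rewrite expr1n mul1r (bigD1 (enum_rank i0))//=.
  rewrite [X in _ + X]big1 ?addr0; last first.
    move=> i /negbTE i0E; rewrite /a' i0E big1 ?normr0 ?expr0n//.
  have := arow T (fun i => x (enum_rank i)).
  rewrite (sum_enum_val (fun i => a i T _)).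
  rewrite (sum_enum_val (fun i => `|x (enum_rank i)| ^+ 2)).
  rewrite (eq_bigr (fun j => a' (enum_rank i0) j T (x j))) => [|j _].
    rewrite [leRHS](eq_bigr (fun j => `|x j| ^+ 2))// => j _.
    by rewrite enum_valK.
  by rewrite /a' eqxx enum_valK.
rewrite expr1n mul1r -(sum_enum_val (fun i => `|k i| ^+ 2)).
apply: le_trans; rewrite [leRHS](bigD1 (enum_rank i0))//= /a' eqxx.
by rewrite sum_enum_val /= lerDl sumr_ge0.
Qed.

End CompletelyContractive.
End OperatorAlgebra.

Section Dilation.
Variables (R : realType) (E : digraph) (X : self_similar E).
Variables (T : toeplitz_rep R X) (pi : ccrep R X) (J : bop (ccrep_of T) pi).
Hypothesis dilJ : is_dilation J.

Let Jiso : is_isometry J. Proof. by case: dilJ. Qed.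

Let dilE a : opalg a -> forall x, adj J (cc_fun pi a (J x)) = a T x.
Proof. by move=> Aa x; case: dilJ => _ /(_ a Aa x) /= ->. Qed.

Lemma dilation_column_tight (I : finType) (a : I -> Defs.family R X) :
  (forall i, opalg (a i)) ->
  (forall (T' : toeplitz_rep R X) x, \sum_i `|a i T' x| ^+ 2 <= `|x| ^+ 2) ->
  (forall x, \sum_i `|a i T x| ^+ 2 = `|x| ^+ 2) ->
  forall i x, cc_fun pi (a i) (J x) = J (a i T x).
Proof.
move=> Aa acol aT i x; rewrite -dilE//.
apply: (isometry_range_tight (k := fun i => cc_fun pi (a i) (J x))
  (M := `|x| ^+ 2)) => //.
  by rewrite -(Jiso x); exact: ccrep_column.
by under eq_bigr do rewrite dilE//.
Qed.

Lemma dilation_row_tight (I : finType) (a : I -> Defs.family R X) :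
  (forall i, opalg (a i)) ->
  (forall (T' : toeplitz_rep R X) x,
    \sum_i `|adj (a i T') x| ^+ 2 <= `|x| ^+ 2) ->
  (forall x, \sum_i `|adj (a i T) x| ^+ 2 = `|x| ^+ 2) ->
  forall i k, adj J (cc_fun pi (a i) k) = a i T (adj J k).
Proof.
move=> Aa arow aT i k.
have diladjE j x : adj J (adj (cc_fun pi (a j)) (J x)) = adj (a j T) x.
  apply: hdot_injr => y; rewrite -!adjP -(dilE (Aa j)).
  by rewrite [RHS]hdotC adjPr -hdotC.
have adjJ x : adj (cc_fun pi (a i)) (J x) = J (adj (a i T) x).
  rewrite -diladjE.
  apply: (isometry_range_tight (k := fun i => adj (cc_fun pi (a i)) (J x))
    (M := `|x| ^+ 2)) => //; last by under eq_bigr do rewrite diladjE.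
  rewrite -(Jiso x); apply: row_contraction_adj; apply: ccrep_row => // T'.
  exact: adj_row_contraction.
apply: hdot_injr => x; rewrite -adjP adjPr adjJ adjP.
by rewrite -adjPr.
Qed.

Definition reduced (a : Defs.family R X) := [/\ opalg a,
  forall x, cc_fun pi a (J x) = J (a T x) &
  forall k, adj J (cc_fun pi a k) = a T (adj J k)].

Lemma reduced_csa : closed_subalgebra reduced.
Proof.
have csA := @opalg_csa R E X.
split.
- have A0 := csa0 csA.
  have pi0 k : cc_fun pi (fam0 (X := X)) k = 0.
    apply/eqP; rewrite -normr_le0 -(mul0r `|k|); apply: ccrep_norm => //.
    by move=> T' x; rewrite mul0r normr0.
  by split=> // [x|k]; rewrite pi0 linear0.
- move=> a b [Aa aJ Ja] [Ab bJ Jb]; split; first exact: (csaD csA).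
    by move=> x; rewrite (ccrepD (cc_prop pi))// aJ bJ -linearD.
  by move=> k; rewrite (ccrepD (cc_prop pi))// linearD Ja Jb.
- move=> c a [Aa aJ Ja]; split; first exact: (csaZ csA).
    by move=> x; rewrite (ccrepZ (cc_prop pi))// aJ -linearZ.
  by move=> k; rewrite (ccrepZ (cc_prop pi))// linearZ Ja.
- move=> a b [Aa aJ Ja] [Ab bJ Jb]; split; first exact: (csaM csA).
    by move=> x; rewrite (ccrepM (cc_prop pi))// bJ aJ.
  by move=> k; rewrite (ccrepM (cc_prop pi))// Ja Jb.
- move=> a aB.
  have Aa : opalg a.
    by apply: (csa_closed csA) => e /aB[b [Ab _ _] ab]; exists b.
  split=> // [x|k]; apply/eqP; rewrite -subr_eq0; apply/eqP.
    apply: (norm_small0 (M := `|x| + `|x|)); first by rewrite addr_ge0.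
    move=> e e0; have [b [Ab bJ Jb] ab] := aB e e0.
    rewrite -(subrKA (cc_fun pi b (J x))); apply: le_trans (ler_normD _ _) _.
    rewrite mulrDr lerD//.
      by rewrite -(Jiso x); apply: ccrep_dist => //; exact: ltW.
    by rewrite bJ -linearB Jiso distrC; exact: ab.
  apply: (norm_small0 (M := `|k| + `|k|)); first by rewrite addr_ge0.
  move=> e e0; have [b [Ab bJ Jb] ab] := aB e e0.
  have adjJ_le u : `|adj J u| <= `|u|.
    by rewrite -(@ler_pXn2r _ 2) ?nnegrE//; exact: adj_isometry_le.
  rewrite -(subrKA (adj J (cc_fun pi b k))); apply: le_trans (ler_normD _ _) _.
  rewrite mulrDr lerD//.
    rewrite -linearB; apply: le_trans (adjJ_le _) _.
    by apply: ccrep_dist => //; exact: ltW.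
  rewrite Jb distrC; apply: le_trans (ab T _) _.
  by rewrite ler_wpM2l// ltW.
Qed.

Hypothesis uckT : unitary_CK T.

Lemma reduced_V : reduced (fam_V (X := X) 1).
Proof.
have [[VV VV'] _] := uckT; have AV := opalg_V (R := R) (X := X) 1.
split=> //.
  apply: (dilation_column_tight (I := unit) (a := fun=> fam_V 1) _ _ _ tt) => //.
    move=> T' x; rewrite big_const card_unit /= addr0.
    by rewrite (trepV_isometry (t := T')).
  by move=> x; rewrite big_const card_unit /= addr0 (trepV_isometry (t := T)).
apply: (dilation_row_tight (I := unit) (a := fun=> fam_V 1) _ _ _ tt) => //.
  move=> T' x; rewrite big_const card_unit /= addr0.
  by apply: adj_isometry_le; exact: trepV_isometry.
move=> x; rewrite big_const card_unit /= addr0.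
by rewrite -[in RHS](VV' x) (trepV_isometry (t := T)).
Qed.

Lemma reduced_S m : reduced (fam_S (X := X) m).
Proof.
have AS := opalg_S (R := R) (X := X) m.
case: m AS => [v|e] AS; split=> //.
- apply: (dilation_column_tight (a := fun v => fam_S (inl v))) => [w|T' x|x].
  + exact: opalg_S.
  + by rewrite tck_vertex_norm//; exact: trepS_TCK.
  + by rewrite tck_vertex_norm//; exact: trepS_TCK.
- have adjS (T' : toeplitz_rep R X) w x :
      adj (trepS T' (inl w)) x = trepS T' (inl w) x.
    by case: (tck_proj (trepS_TCK T') w).
  apply: (dilation_row_tight (a := fun v => fam_S (inl v))) => [w|T' x|x].
  + exact: opalg_S.
  + under eq_bigr do rewrite adjS.
    by rewrite tck_vertex_norm//; exact: trepS_TCK.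
  + under eq_bigr do rewrite adjS.
    by rewrite tck_vertex_norm//; exact: trepS_TCK.
- (* [S_e] has initial projection [S_(src e)], so it forms an isometric column
     with the other vertex projections. *)
  pose a v := fam_S (R := R) (X := X)
    (if v == src e then inr e else inl v).
  have aE (T' : toeplitz_rep R X) x : \sum_v `|a v T' x| ^+ 2 = `|x| ^+ 2.
    rewrite -(tck_vertex_norm (trepS_TCK T')); apply: eq_bigr => v _.
    rewrite /a /fam_S; case: eqP => // ->.
    by rewrite (tck_edge_norm (trepS_TCK T')).
  have := @dilation_column_tight _ a _ _ _ (src e).
  by rewrite {4 5}/a eqxx; apply => // [v|T' x]; [exact: opalg_S|rewrite aE].
- apply: (dilation_row_tight (a := fun e => fam_S (inr e))) => [f|T' x|x].
  + exact: opalg_S.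
  + by apply: tck_edge_adj_norm; exact: trepS_TCK.
  + by apply: ck_edge_adj_norm; [exact: trepS_TCK|case: uckT].
Qed.

Lemma opalg_reduced a : opalg a -> reduced a.
Proof.
apply; first exact: reduced_csa.
by apply: csa_gen => //; [exact: reduced_csa|exact: reduced_S|exact: reduced_V].
Qed.

Let J' : bop (kernel_hilbert (adj J)) pi := kernel_incl (adj J).

Let J'K k : adj J k = 0 -> J' (adj J' k) = k.
Proof.
by move=> /kernel_inclP[y ->]; rewrite isometryK//; exact: kernel_incl_isometry.
Qed.

Definition complement_fun (a : Defs.family R X) :=
  bop_comp (adj J') (bop_comp (cc_fun pi a) J').

Let J'E a : opalg a -> forall y, J' (complement_fun a y) = cc_fun pi a (J' y).
Proof.
move=> /opalg_reduced[_ _ Ja] y; rewrite J'K// Ja.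
by rewrite (_ : adj J (J' y) = 0) ?linear0//; exact: kernel_inclK.
Qed.

Lemma complement_is_ccrep : is_ccrep complement_fun.
Proof.
split.
- by move=> a b Aa Ab x; rewrite /= (ccrepD (cc_prop pi))// linearD.
- by move=> c a Aa x; rewrite /= (ccrepZ (cc_prop pi))// linearZ.
- move=> a b Aa Ab x; rewrite /= (ccrepM (cc_prop pi))//.
  by have /= -> := J'E Ab x.
- move=> n a M M0 Aa aM x.
  apply: le_trans (ccrep_cc (cc_prop pi) M0 Aa aM (fun j => J' (x j))).
  apply: ler_sum => i _; rewrite -linear_sum.
  by apply: adj_isometry_le; exact: kernel_incl_isometry.
Qed.

Lemma dilation_direct_sum :
  exists (sigma : ccrep R X) (J' : bop sigma pi), is_direct_sum J J'.
Proof.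
exists (CCRep complement_is_ccrep), J'; split=> //.
- by move=> x y; rewrite adjP [adj J _]kernel_inclK linear0r.
- move=> k; have : adj J (k - J (adj J k)) = 0.
    by rewrite linearB/= (isometryK Jiso) subrr.
  move=> /kernel_inclP[y yE]; exists (adj J k), y.
  by rewrite -[J' y]yE addrC subrK.
- move=> a Aa x y; have [_ aJ _] := opalg_reduced Aa.
  by rewrite linearD aJ /= -[in LHS](J'E Aa).
Qed.

End Dilation.

Theorem proposition5p2 (R : realType) (E : digraph) (sfE : source_free E)
    (X : self_similar E)
    (HX : forall e : edge E, exists m : nat, ss_res X m (inr e) <> 0%N)
    (T : toeplitz_rep R X) (uckT : unitary_CK T) :
  maximal (ccrep_of T).
Proof. by move=> pi J dilJ; exact: dilation_direct_sum. Qed.
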